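(* Let $M$ be a right $R$-module and consider: (i) $M$ is finite $\Sigma$-Rickart; (ii) $\mathfrak{F}_M$ is closed under $M$-pure epimorphisms, i.e. if $A\in\mathfrak{F}_M$ and $\mu:A\to A'$ is an $M$-pure epimorphism then $A'\in\mathfrak{F}_M$; (iii) whenever $\mu:A\to A'$ is an $M$-pure epimorphism with $A$ $M$-injective, $A'\in\mathfrak{F}_M$. Then (i)$\Rightarrow$(ii)$\Rightarrow$(iii). If moreover $M$ is $M^{(\mathcal{I})}$-projective for every index set $\mathcal{I}$, then (i), (ii), (iii) are equivalent.
   Context: Modules are unitary right $R$-modules; $M^{(\mathcal I)}$ is the direct sum of copies of $M$ indexed by $\mathcal I$. $M$ is Rickart if $\ker\varphi$ is a direct summand of $M$ for all $\varphi\in\mathrm{End}_R(M)$; $M$ is finite $\Sigma$-Rickart if $M^{(n)}$ is Rickart for all integers $n>0$. A module $N$ is finitely $M$-generated if there is an epimorphism $M^{(n)}\to N$ for some $n>0$. $\mathfrak{F}_M$ is the class of right $R$-modules $A$ such that for every monomorphism $\alpha:N\to M$ with $N$ finitely $M$-generated and every homomorphism $\beta:N\to A$ there is $\gamma:M\to A$ with $\beta=\gamma\alpha$. An epimorphism $\mu:A\to B$ is $M$-pure if for every homomorphism $\beta:M\to B$ there exists $\gamma:M\to A$ with $\mu\gamma=\beta$. *)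

(* Defs.v *)
From HB Require Import structures.
From mathcomp Require Import all_boot all_order all_algebra.
From mathcomp Require Import boolp classical_sets cardinality functions.

Set Implicit Arguments.
Unset Strict Implicit.
Unset Printing Implicit Defensive.
Import GRing.Theory.
Local Open Scope classical_set_scope.
Local Open Scope ring_scope.

(* Conventions: a right R-module is a left module over the converse ring R^c,
   i.e. an [lmodType R^c].  Homomorphisms are [{linear A -> B}].
   All the notions below are stated for modules over an arbitrary ring S
   (to be instantiated with S := R^c). *)

Section ModuleNotions.
Variable S : pzRingType.

Definition is_submodule (M : lmodType S) (K : set M) : Prop :=
  K 0 /\ (forall x y, K x -> K y -> K (x + y)) /\
  (forall (a : S) x, K x -> K (a *: x)).

Definition is_direct_summand (M : lmodType S) (K : set M) : Prop :=
  is_submodule K /\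
  exists L : set M, is_submodule L /\
    (forall x, K x -> L x -> x = 0) /\
    (forall x, exists k l, K k /\ L l /\ x = k + l).

Definition kernel (A B : lmodType S) (f : {linear A -> B}) : set A :=
  [set x | f x = 0].

Definition rickart (M : lmodType S) : Prop :=
  forall phi : {linear M -> M}, is_direct_summand (kernel phi).

Definition Mpow (n : nat) (M : lmodType S) : lmodType S := {ffun 'I_n -> M}.

Definition fin_sigma_rickart (M : lmodType S) : Prop :=
  forall n : nat, (0 < n)%N -> rickart (Mpow n M).

Definition is_mono (A B : lmodType S) (f : {linear A -> B}) : Prop :=
  forall x y, f x = f y -> x = y.

Definition is_epi (A B : lmodType S) (f : {linear A -> B}) : Prop :=
  forall y, exists x, f x = y.

Definition fin_M_generated (M N : lmodType S) : Prop :=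
  exists n : nat, (0 < n)%N /\ exists f : {linear Mpow n M -> N}, is_epi f.

Definition in_FM (M A : lmodType S) : Prop :=
  forall (N : lmodType S) (alpha : {linear N -> M}),
    is_mono alpha -> fin_M_generated M N ->
    forall beta : {linear N -> A},
      exists gamma : {linear M -> A}, forall x, beta x = gamma (alpha x).

Definition M_pure_epi (M A B : lmodType S) (mu : {linear A -> B}) : Prop :=
  is_epi mu /\
  forall beta : {linear M -> B},
    exists gamma : {linear M -> A}, forall x, mu (gamma x) = beta x.

Definition M_injective (M A : lmodType S) : Prop :=
  forall (N : lmodType S) (alpha : {linear N -> M}),
    is_mono alpha ->
    forall beta : {linear N -> A},
      exists gamma : {linear M -> A}, forall x, beta x = gamma (alpha x).

Definition rel_projective (M N : lmodType S) : Prop :=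
  forall (K : lmodType S) (g : {linear N -> K}), is_epi g ->
    forall f : {linear M -> K},
      exists h : {linear M -> N}, forall x, g (h x) = f x.

Definition fin_supp (I : Type) (M : lmodType S) : pred (I -> M) :=
  fun f => `[< finite_set [set i | f i != 0] >].

Lemma fin_supp_submod_closed (I : Type) (M : lmodType S) :
  GRing.submod_closed (@fin_supp I M).
Proof.
split.
  apply/asboolP; rewrite (_ : [set i | _] = set0); first exact: finite_set0.
  by apply/seteqP; split => i //=; rewrite eqxx.
move=> a u v /asboolP Hu /asboolP Hv; apply/asboolP.
have HU : finite_set ([set i | u i != 0] `|` [set i | v i != 0]).
  by rewrite finite_setU.
apply: (sub_finite_set _ HU) => i /=.
rewrite [X in X != 0]/GRing.add /= [X in X + _]/GRing.scale /=.
case: (eqVneq (u i) 0) => [-> | ?]; last by left.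
case: (eqVneq (v i) 0) => [-> | ?]; last by right.
by rewrite scaler0 addr0 eqxx.
Qed.

HB.instance Definition _ (I : Type) (M : lmodType S) :=
  GRing.isSubmodClosed.Build S (I -> M) (@fin_supp I M)
    (fin_supp_submod_closed I M).

Definition dsum (I : Type) (M : lmodType S) := {f : I -> M | f \in @fin_supp I M}.
HB.instance Definition _ (I : Type) (M : lmodType S) :=
  SubType.copy (dsum I M) {f : I -> M | f \in @fin_supp I M}.
HB.instance Definition _ (I : Type) (M : lmodType S) :=
  Choice.copy (dsum I M) {f : I -> M | f \in @fin_supp I M}.
HB.instance Definition _ (I : Type) (M : lmodType S) :=
  [SubChoice_isSubLmodule of dsum I M by <:].

End ModuleNotions.

Definition FM_closed_pure_epi (S : pzRingType) (M : lmodType S) : Prop :=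
  forall (A A' : lmodType S) (mu : {linear A -> A'}),
    in_FM M A -> M_pure_epi M mu -> in_FM M A'.

Definition FM_contains_pure_epi_images_of_injectives
    (S : pzRingType) (M : lmodType S) : Prop :=
  forall (A A' : lmodType S) (mu : {linear A -> A'}),
    M_injective M A -> M_pure_epi M mu -> in_FM M A'.

(* Main.v *)
(* (i) => (ii): if M^n is Rickart, an epimorphism from M^n onto a submodule N
   of M splits, so maps out of N lift along M-pure epimorphisms because maps
   out of M^n do.
   (iii) => (i): embed V = M^n in an injective module and let A be the trace of
   M there; A is M-injective, contains V and is a quotient of some M^(I), so by
   projectivity A -> A/K is M-pure for every submodule K.  For K = ker psi with
   psi : V -> M, the inclusion psi(V) = V/K -> A/K extends to M and lifts to A,
   which splits V -> psi(V).  The kernel of an endomorphism of M^n is an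
   intersection of n such kernels, and splitting passes to the intersection.
   Injective modules come from the coinduced modules Hom_Z(S, D), with D a
   divisible abelian group. *)
Require Import Defs.
From HB Require Import structures.
From mathcomp Require Import all_boot all_order all_algebra.
From mathcomp Require Import finmap boolp classical_sets cardinality functions fsbigop.

Set Implicit Arguments.
Unset Strict Implicit.
Unset Printing Implicit Defensive.
Import Order.TTheory GRing.Theory Num.Theory.
Local Open Scope classical_set_scope.
Local Open Scope ring_scope.

(** * Submodules as modules in their own right *)

Section Submodules.
Variables (S : pzRingType) (A : lmodType S) (K : set A).
Hypothesis subK : is_submodule K.

Lemma submodule0 : K 0. Proof. by case: subK. Qed.

Lemma submoduleD x y : K x -> K y -> K (x + y).
Proof. by case: subK => _ [h _]; exact: h. Qed.

Lemma submoduleZ a x : K x -> K (a *: x).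
Proof. by case: subK => _ [_ h]; exact: h. Qed.

Lemma submoduleN x : K x -> K (- x).
Proof. by move=> Kx; rewrite -scaleN1r; exact: submoduleZ. Qed.

Lemma submoduleB x y : K x -> K y -> K (x - y).
Proof. by move=> Kx Ky; apply: submoduleD => //; exact: submoduleN. Qed.

End Submodules.

Section SubmoduleType.
Variables (S : pzRingType) (A : lmodType S).

Definition submodule_pred (K : set A) (subK : is_submodule K) : pred A :=
  fun x => `[< K x >].

Variables (K : set A) (subK : is_submodule K).

Lemma submodule_pred_closed : GRing.submod_closed (submodule_pred subK).
Proof.
split; first exact/asboolP/(submodule0 subK).
move=> a x y /asboolP Kx /asboolP Ky; apply/asboolP.
by apply: (submoduleD subK) => //; exact: (submoduleZ subK).
Qed.

HB.instance Definition _ := GRing.isSubmodClosed.Build S A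
  (submodule_pred subK) submodule_pred_closed.

Definition submodule_type := {x : A | x \in submodule_pred subK}.
HB.instance Definition _ := SubType.copy submodule_type
  {x : A | x \in submodule_pred subK}.
HB.instance Definition _ := Choice.copy submodule_type
  {x : A | x \in submodule_pred subK}.
HB.instance Definition _ := [SubChoice_isSubLmodule of submodule_type by <:].

Lemma submodule_as_module : exists (N : lmodType S) (i : {linear N -> A}),
  is_mono i /\ forall x, K x <-> exists n, i n = x.
Proof.
exists submodule_type, (\val : {linear submodule_type -> A}); split.
  by move=> x y; exact: val_inj.
move=> x; split=> [Kx | [n <-]]; last exact/asboolP/(valP n).
have mx : x \in submodule_pred subK by exact/asboolP.
by exists (exist _ x mx : submodule_type).
Qed.

End SubmoduleType.

(** * Quotient modules *)

Section QuotientType.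
Variables (S : pzRingType) (A : lmodType S).

(** The choice is made from a set depending only on the coset of [x], so congruent elements get
    equal representatives and the quotient can be carried by the fixed points. The fallback 0 is
    never taken, as [x] lies in its own coset. *)
Definition coset_repr (K : set A) (subK : is_submodule K) (x : A) : A :=
  xget 0 [set y | K (x - y)].

Variables (K : set A) (subK : is_submodule K).
Local Notation rep := (coset_repr subK).

Lemma coset_reprP x : K (x - rep x).
Proof.
by rewrite /coset_repr; case: xgetP => [y _ //|/(_ x)[]]; rewrite /= subrr;
  exact: (submodule0 subK).
Qed.

Lemma coset_repr_eq x y : K (x - y) -> rep x = rep y.
Proof.
move=> Kxy; congr (xget 0 _); apply/seteqP; split=> z /= Kz.
  rewrite -[y - z](subrKA x); apply: (submoduleD subK) => //.
  by rewrite -opprB; exact: (submoduleN subK).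
by rewrite -[x - z](subrKA y); exact: (submoduleD subK).
Qed.

Lemma coset_repr_idem x : rep (rep x) == rep x.
Proof.
apply/eqP/coset_repr_eq; rewrite -opprB.
exact/(submoduleN subK)/coset_reprP.
Qed.

Definition quotient_type := {x : A | rep x == x}.
HB.instance Definition _ := SubType.copy quotient_type {x : A | rep x == x}.
HB.instance Definition _ := Choice.copy quotient_type {x : A | rep x == x}.

Definition coset_of (x : A) : quotient_type :=
  exist _ (rep x) (coset_repr_idem x).

Lemma coset_of_eqP x y : coset_of x = coset_of y <-> K (x - y).
Proof.
split=> [/(congr1 val) /= e | Kxy]; last exact/val_inj/coset_repr_eq.
rewrite -[x - y](subrKA (rep x)).
apply: (submoduleD subK); first exact: coset_reprP.
by rewrite e -opprB; exact/(submoduleN subK)/coset_reprP.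
Qed.

Lemma coset_of_val (q : quotient_type) : coset_of (val q) = q.
Proof. by apply: val_inj => /=; exact/eqP/(valP q). Qed.

Definition quotient_add (p q : quotient_type) := coset_of (val p + val q).
Definition quotient_opp (p : quotient_type) := coset_of (- val p).
Definition quotient_scale a (p : quotient_type) := coset_of (a *: val p).

Lemma coset_ofD x y : quotient_add (coset_of x) (coset_of y) = coset_of (x + y).
Proof.
apply/coset_of_eqP => /=; rewrite opprD addrACA -opprB -[rep y - y]opprB.
by apply: (submoduleD subK); exact/(submoduleN subK)/coset_reprP.
Qed.

Lemma coset_ofN x : quotient_opp (coset_of x) = coset_of (- x).
Proof. by apply/coset_of_eqP => /=; rewrite opprK addrC; exact: coset_reprP. Qed.

Lemma coset_ofZ a x : quotient_scale a (coset_of x) = coset_of (a *: x).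
Proof.
apply/coset_of_eqP => /=; rewrite -scalerBr -opprB.
exact/(submoduleZ subK)/(submoduleN subK)/coset_reprP.
Qed.

Lemma quotient_addA : associative quotient_add.
Proof.
move=> p q r; rewrite -(coset_of_val p) -(coset_of_val q) -(coset_of_val r).
by rewrite !coset_ofD addrA.
Qed.

Lemma quotient_addC : commutative quotient_add.
Proof. by move=> p q; rewrite /quotient_add addrC. Qed.

Lemma quotient_add0 : left_id (coset_of 0) quotient_add.
Proof. by move=> p; rewrite -(coset_of_val p) coset_ofD add0r. Qed.

Lemma quotient_addN : left_inverse (coset_of 0) quotient_opp quotient_add.
Proof. by move=> p; rewrite -(coset_of_val p) coset_ofN coset_ofD addNr. Qed.

HB.instance Definition _ := GRing.isZmodule.Build quotient_type
  quotient_addA quotient_addC quotient_add0 quotient_addN.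

Lemma quotient_scaleA a b p :
  quotient_scale a (quotient_scale b p) = quotient_scale (a * b) p.
Proof. by rewrite -(coset_of_val p) !coset_ofZ scalerA. Qed.

Lemma quotient_scale1 : left_id 1 quotient_scale.
Proof. by move=> p; rewrite -(coset_of_val p) coset_ofZ scale1r. Qed.

Lemma quotient_scaleDr : right_distributive quotient_scale +%R.
Proof.
move=> a p q; rewrite -(coset_of_val p) -(coset_of_val q).
by rewrite [_ + _]coset_ofD !coset_ofZ [RHS]coset_ofD scalerDr.
Qed.

Lemma quotient_scaleDl p :
  {morph quotient_scale^~ p : a b / a + b}.
Proof.
by move=> a b; rewrite -(coset_of_val p) !coset_ofZ [RHS]coset_ofD scalerDl.
Qed.

HB.instance Definition _ := GRing.Zmodule_isLmodule.Build S quotient_type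
  quotient_scaleA quotient_scale1 quotient_scaleDr quotient_scaleDl.

Lemma coset_of_linear : linear coset_of.
Proof. by move=> a x y; rewrite -coset_ofD -coset_ofZ. Qed.

HB.instance Definition _ :=
  GRing.isLinear.Build S A quotient_type _ coset_of coset_of_linear.

Lemma quotient_as_module : exists (Q : lmodType S) (p : {linear A -> Q}),
  is_epi p /\ forall x, p x = 0 <-> K x.
Proof.
exists quotient_type, coset_of; split=> [q | x].
  by exists (val q); exact: coset_of_val.
by have := coset_of_eqP x 0; rewrite subr0.
Qed.

End QuotientType.

(** * Factorization of linear maps, and retracts *)

Section LinearMaps.
Variable S : pzRingType.
Implicit Types A B C : lmodType S.

Lemma linear_of_fun A B (f : A -> B) :
  linear f -> exists g : {linear A -> B}, g =1 f.
Proof.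
move=> lin_f.
by exists (HB.pack f (GRing.isLinear.Build _ _ _ _ f lin_f) : {linear A -> B}).
Qed.

Lemma kernel_submodule A B (f : {linear A -> B}) : is_submodule (kernel f).
Proof.
rewrite /kernel; split; first exact: raddf0.
split=> [x y | a x] /= fx; first by move=> fy; rewrite raddfD /= fx fy addr0.
by rewrite linearZ_LR /= fx scaler0.
Qed.

Lemma image_submodule A B (f : {linear A -> B}) (K : set A) :
  is_submodule K -> is_submodule (f @` K).
Proof.
move=> subK; split; first by exists 0; [exact: (submodule0 subK)|exact: raddf0].
split=> [_ _ [x Kx <-] [y Ky <-] | a _ [x Kx <-]].
  by exists (x + y); [exact: (submoduleD subK)|exact: raddfD].
by exists (a *: x); [exact: (submoduleZ subK)|exact: linearZ_LR].
Qed.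

Lemma setT_submodule A : is_submodule [set: A].
Proof. by []. Qed.

Lemma factor_through_mono A B C (i : {linear A -> B}) (g : {linear C -> B}) :
    is_mono i -> (forall x, exists y, i y = g x) ->
  exists h : {linear C -> A}, forall x, i (h x) = g x.
Proof.
move=> mono_i im; have [h hP] := choice im.
have [|h' h'P] := @linear_of_fun C A h; last first.
  by exists h' => x; rewrite h'P hP.
by move=> a x y; apply: mono_i; rewrite hP !linearP !hP.
Qed.

(** A set-theoretic section of [p] need not be additive, but [g] is constant on the fibres of [p],
    so its composite with the section is linear. *)
Lemma factor_through_epi A B C (p : {linear A -> B}) (g : {linear A -> C}) :
    is_epi p -> (forall x, p x = 0 -> g x = 0) ->
  exists h : {linear B -> C}, forall x, h (p x) = g x.
Proof.
move=> epi_p kerp; have [s sP] := choice epi_p.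
have gs x y : p x = p y -> g x = g y.
  move=> e; apply/eqP; rewrite -subr_eq0 -raddfB.
  by apply/eqP/kerp; rewrite raddfB /= e subrr.
have [|h hP] := @linear_of_fun B C (g \o s); last first.
  by exists h => x; rewrite hP /=; apply: gs; rewrite sP.
by move=> a x y /=; rewrite -linearP; apply: gs; rewrite linearP !sP.
Qed.

(** Such an [e] is idempotent with image [K]. Direct summands in this form can be handled by
    composing maps, with no complement to carry along. *)
Definition is_retract A (K : set A) : Prop :=
  exists e : {linear A -> A}, (forall x, K (e x)) /\ (forall x, K x -> e x = x).

Lemma retract_direct_summand A (K : set A) :
  is_submodule K -> is_retract K -> is_direct_summand K.
Proof.
move=> subK [e [eK Ke]]; split=> //; exists (kernel e).
split; first exact: kernel_submodule.
split=> [x Kx ex | x]; first by rewrite -(Ke x Kx).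
exists (e x), (x - e x); split; first exact: eK.
by split; [rewrite /kernel /= raddfB /= (Ke (e x)) ?subrr | rewrite subrKC].
Qed.

(** Because [K] meets its complement trivially, the [K]-component of an element is unique, and
    uniqueness makes the chosen component linear. *)
Lemma direct_summand_retract A (K : set A) :
  is_direct_summand K -> is_retract K.
Proof.
move=> [subK [L [subL [KL0 decomp]]]]; have [k kP] := choice decomp.
have uniq_k x u v : K u -> L v -> x = u + v -> u = k x.
  move=> Ku Lv xE; have [l [Kk [Ll xE']]] := kP x.
  apply/eqP; rewrite -subr_eq0; apply/eqP/KL0; first exact: (submoduleB subK).
  suff -> : u - k x = l - v by exact: (submoduleB subL).
  by apply/eqP; rewrite subr_eq addrAC eq_sym subr_eq addrC -xE' xE.
have [|e eP] := @linear_of_fun A A k.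
  move=> a x y; apply/esym.
  have [l [Kk [Ll xE]]] := kP x; have [l' [Kk' [Ll' yE]]] := kP y.
  apply: (uniq_k _ _ (a *: l + l')).
  - by apply: (submoduleD subK) => //; exact: (submoduleZ subK).
  - by apply: (submoduleD subL) => //; exact: (submoduleZ subL).
  - by rewrite addrACA -scalerDr -xE -yE.
exists e; split=> x; rewrite eP; first by case: (kP x) => l [].
by move=> Kx; apply/esym/(uniq_k x x 0); rewrite ?addr0 //; exact: (submodule0 subL).
Qed.

(** The map id - e vanishes on the kernel of [p], hence factors through [p]; the factor is a section
    because [p] kills the values of e. *)
Lemma epi_section A B (p : {linear A -> B}) : is_epi p -> is_retract (kernel p) ->
  exists s : {linear B -> A}, forall x, p (s x) = x.
Proof.
move=> epi_p [e [eK Ke]].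
have [|s sP] := @factor_through_epi A B A p (idfun \- e) epi_p.
  by move=> x px; rewrite /= Ke // subrr.
exists s => y; have [x <-] := epi_p y.
by rewrite sP /= raddfB /= (eK x) subr0.
Qed.

(* With e' the projection onto the kernel of f o e, the composite e o e' o e
   is a projection onto K `&` kernel f. *)
Lemma retract_capI A B (K : set A) (f : {linear A -> B}) :
    (forall g : {linear A -> B}, is_retract (kernel g)) ->
  is_retract K -> is_retract (K `&` kernel f).
Proof.
move=> kerB [e [eK Ke]]; have [e' [e'K Ke']] := kerB (f \o e).
exists (e \o e' \o e); split=> [x | x [Kx fx]] /=.
  by split; [exact: eK | exact: (e'K (e x))].
by rewrite !(Ke x) // Ke' ?Ke //= /kernel /= Ke.
Qed.

End LinearMaps.

(** * Divisible abelian groups: extension of homomorphisms and embeddings *)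

Lemma int_subgroup_principal (P : int -> Prop) :
    P 0 -> (forall a b, P a -> P b -> P (a - b)) ->
  exists m : nat, forall k, P k <-> (m%:Z %| k)%Z.
Proof.
move=> P0 PB.
have PN a : P a -> P (- a) by move=> Pa; rewrite -sub0r; exact: PB.
have PD a b : P a -> P b -> P (a + b).
  by move=> Pa Pb; rewrite -[b]opprK; apply: PB => //; exact: PN.
have PMn a n : P a -> P (a *+ n).
  by move=> Pa; elim: n => [|n IH]; rewrite ?mulr0n // mulrS; exact: PD.
have PMz a k : P a -> P (k * a).
  move=> Pa; case: (intP k) => [|n|n]; rewrite ?mul0r // ?mulNr.
    by rewrite -natz mulr_natl; exact: PMn.
  by apply: PN; rewrite -natz mulr_natl; exact: PMn.
(* The generator is the least positive element of [P], or 0 if there is none. *)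
have [[m0 /andP[m0_gt0 Pm0]] | noP] :=
    pselect (exists m : nat, (0 < m)%N && `[< P m >]); last first.
  exists 0%N => k; rewrite dvd0z; split=> [Pk | /eqP -> //].
  apply: contraT => k_neq0; case: noP; exists `|k|%N.
  rewrite absz_gt0 k_neq0; apply/asboolP.
  by rewrite abszE; case: (ger0P k) => _ //; exact: PN.
have exm : exists m : nat, (0 < m)%N && `[< P m >] by exists m0; rewrite m0_gt0.
case: (ex_minnP exm) => m /andP[m_gt0 /asboolP Pm] min_m; exists m => k.
split=> [Pk | /dvdzP[q ->]]; last exact: PMz.
(* The remainder of [k] modulo [m] is again in [P], so a nonzero one would contradict the minimality
   of [m]. *)
apply/dvdz_mod0P/eqP; apply: contraT => r_neq0.
have m_neq0 : m%:Z != 0 by rewrite eqz_nat -lt0n.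
have r_ge0 : (0 <= k %% m)%Z by exact: modz_ge0.
have Pr : P (k %% m)%Z by rewrite /modz; apply: PB => //; exact: PMz.
have := min_m `|(k %% m)%Z|%N.
rewrite absz_gt0 r_neq0 /= => /(_ _)/wrap[].
  by apply/asboolP; rewrite gez0_abs.
rewrite -lez_nat gez0_abs // leNgt.
by have := ltz_mod k m_neq0; rewrite ger0_norm // => ->.
Qed.

Definition divisible (D : zmodType) : Prop :=
  forall n (d : D), (0 < n)%N -> exists e : D, e *+ n = d.

Section AdditiveGraphs.
Variables V D : zmodType.

(** Partial homomorphisms are encoded by their graphs, so that extension is inclusion of sets and
    Zorn's lemma applies. The empty set qualifies, whence the separate hypothesis [G 0] further
    on. *)
Definition additive_graph (G : set (V * D)) : Prop :=
  (forall p q, G p -> G q -> G (p - q)) /\ (forall d, G (0, d) -> d = 0).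

Lemma additive_graph_inj (G : set (V * D)) x d e :
  additive_graph G -> G (x, d) -> G (x, e) -> d = e.
Proof.
move=> [GB G0] Gd Ge; apply/eqP; rewrite -subr_eq0; apply/eqP/G0.
by have := GB _ _ Gd Ge; rewrite -[_ - _]/(x - x, d - e) subrr.
Qed.

Lemma additive_graphMz (G : set (V * D)) x d k :
  additive_graph G -> G (x, d) -> G (x *~ k, d *~ k).
Proof.
move=> [GB G0] Gd.
have G00 : G (0, 0) by have := GB _ _ Gd Gd; rewrite subrr.
have GN p : G p -> G (- p).
  by move=> Gp; rewrite -sub0r; exact: GB.
have Gn n : G (x *+ n, d *+ n).
  elim: n => [|n IH] //; rewrite !mulrSr.
  have := GB _ _ IH (GN _ Gd); rewrite -[_ - _]/(x *+ n - - x, d *+ n - - d).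
  by rewrite !opprK.
case: k => n; first exact: Gn.
by rewrite NegzE !mulrNz; exact: (GN (x *+ n.+1, d *+ n.+1)).
Qed.

(** The hypothesis on [e] keeps the extension single-valued: a multiple of [y] already in the domain
    has the value that [e] prescribes. *)
Lemma additive_graph_adjoin (G : set (V * D)) y e :
    additive_graph G -> (forall k d, G (y *~ k, d) -> d = e *~ k) ->
  additive_graph [set p | exists g k, G g /\ p = (g.1 + y *~ k, g.2 + e *~ k)].
Proof.
move=> graphG ye; have [GB G0] := graphG; split=> [p q | d].
  move=> [g [k [Gg ->]]] [h [l [Gh ->]]]; exists (g - h), (k - l).
  split; first exact: GB.
  rewrite -[LHS]/(_ - _, _ - _) -[g - h]/(g.1 - h.1, g.2 - h.2) /=.
  by congr pair; rewrite mulrzBr opprD addrACA.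
move=> [[v c] [k [Gvc [/eqP]]]] /=.
rewrite eq_sym addr_eq0 => /eqP vE ->.
have := additive_graphMz (-1) graphG Gvc.
rewrite vE !mulrNz !mulr1z opprK => /ye <-.
exact: subrr.
Qed.

Hypothesis divD : divisible D.

(** The integers k with ky in the domain of [G] form a subgroup mZ. Dividing the value at my by m
    gives [e]; if m = 0, then [e] = 0 will do. *)
Lemma divisible_value (G : set (V * D)) y : additive_graph G -> G 0 ->
  exists e, forall k d, G (y *~ k, d) -> d = e *~ k.
Proof.
move=> graphG G00; have [GB G0] := graphG.
have [||m mP] := @int_subgroup_principal (fun k => exists d, G (y *~ k, d)).
- by exists 0; rewrite mulr0z.
- move=> a b [d Gd] [e Ge]; exists (d - e); rewrite mulrzBr.
  exact: (GB _ _ Gd Ge).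
have [d0 Gd0] : exists d, G (y *~ m, d) by apply/mP.
have [m0 | m_gt0] := posnP m.
  exists 0 => k d Gd; rewrite mul0rz; apply: G0.
  have : (m %| k)%Z by apply/mP; exists d.
  rewrite m0 dvd0z => /eqP k0.
  by move: Gd; rewrite k0 mulr0z.
have [e eE] := divD d0 m_gt0; exists e => k d Gd.
have /dvdzP[q kE] : (m %| k)%Z by apply/mP; exists d.
apply: (additive_graph_inj graphG Gd); rewrite kE mulrC !mulrzA.
by rewrite -[e *~ m]/(e *+ m) eE; exact: additive_graphMz.
Qed.

(** A maximal partial homomorphism is total, since [divisible_value] would extend it to any missing
    element. *)
Lemma divisible_extension (G : set (V * D)) : additive_graph G -> G 0 ->
  exists2 f : V -> D, {morph f : x y / x - y} & forall x d, G (x, d) -> f x = d.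
Proof.
move=> graphG G00.
(* Zorn's lemma ranges over the sets whose union with [G] is a graph, so that the empty chain is
   bounded as well. *)
have [|H [graphH maxH]] :=
    @Zorn_bigcup _ [set H : set (V * D) | additive_graph (G `|` H)].
  move=> F FP totF; split.
    move=> p q [Gp | [X FX Xp]] [Gq | [Y FY Yq]].
    - by left; exact: graphG.1.
    - by case: ((FP _ FY).1 p q) => [||?|?]; [left|right|left|right; exists Y].
    - by case: ((FP _ FX).1 p q) => [||?|?]; [right|left|left|right; exists X].
    - have [XY | YX] := totF _ _ FX FY.
        case: ((FP _ FY).1 p q) => [||?|?];
          by [right; exact: XY|right|left|right; exists Y].
      case: ((FP _ FX).1 p q) => [||?|?];
        by [right|right; exact: YX|left|right; exists X].
  move=> d [Gd | [X FX Xd]]; first exact: graphG.2.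
  by apply: (FP _ FX).2; right.
have GH00 : (G `|` H) 0 by left.
have total x : exists d, (G `|` H) (x, d).
  have [e eP] := divisible_value x graphH GH00.
  set H' := [set p | exists g k, (G `|` H) g /\ p = (g.1 + x *~ k, g.2 + e *~ k)].
  have GHH' : G `|` H `<=` H'.
    by move=> [v c] GHp; exists (v, c), 0; rewrite !mulr0z !addr0.
  exists e; apply: contrapT => nGH; apply: (maxH H'); last first.
    rewrite /= (_ : G `|` H' = H'); first exact: additive_graph_adjoin.
    by apply/setUidPr => p Gp; apply: GHH'; left.
  split=> [|H'H]; first by move=> p Hp; apply: GHH'; right.
  apply: nGH; right; apply: H'H; exists 0, 1; split=> //.
  by rewrite !mulr1z !add0r.
have [f fP] := choice total; exists f => [x y | x d Gd].
  exact: (additive_graph_inj graphH (fP _) (graphH.1 _ _ (fP x) (fP y))).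
by apply: (additive_graph_inj graphH (fP x)); left.
Qed.

End AdditiveGraphs.

(** The group is Q/Z, and [c] is the class of 1/m. The case m = 0 stands for elements of infinite
    order; there any nonzero class serves, such as that of 1/2. *)
Lemma exists_divisible_torsion : exists2 C : zmodType, divisible C &
  forall m : nat, m != 1%N -> exists2 c : C, c != 0 & c *+ m = 0.
Proof.
have subZ : @is_submodule int (zmodule rat) [set x : rat | x \is a Num.int].
  split; first exact: int_num0.
  split=> [x y | a x] /=; first exact: rpredD.
  by move=> ?; rewrite scalezrE rpredMz.
have [C [p [epi_p kerp]]] := quotient_as_module subZ.
exists C => [n c n_gt0 | m m_neq1].
  have [x <-] := epi_p c.
  exists (p ((x : rat) / n%:R)); rewrite -raddfMn /=; congr (p _).
  by rewrite -[LHS](@mulr_natr rat) divfK // pnatr_eq0 -lt0n.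
have torsion n : (1 < n)%N -> p (n%:R^-1 : rat) != 0.
  move=> n_gt1; have n_gt0 : (0 : rat) < n%:R by rewrite ltr0n ltnW.
  (* A nonzero integer has absolute value at least 1, whereas 0 < 1/n < 1. *)
  apply/eqP/kerp => /= /(norm_intr_ge1); rewrite invr_eq0 gt_eqF // => /(_ isT).
  by rewrite gtr0_norm ?invr_gt0 // invf_ge1 // lern1 leqNgt n_gt1.
have [-> | m_gt0] := posnP m; first by exists (p (2%:R^-1 : rat)); rewrite ?torsion.
exists (p (m%:R^-1 : rat)); first by apply: torsion; rewrite ltn_neqAle eq_sym m_neq1.
rewrite -raddfMn; apply/kerp => /=.
rewrite -[_ *+ _](@mulr_natr rat) mulVf ?int_num1 // pnatr_eq0.
by rewrite -lt0n.
Qed.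

(** Each nonzero [x] is detected by some homomorphism from [V] to Q/Z; the product of these over all
    [x] embeds [V] in a power of Q/Z. *)
Lemma embed_in_divisible (V : zmodType) :
  exists2 D : zmodType, divisible D &
  exists2 j : V -> D, {morph j : x y / x - y} & injective j.
Proof.
have [C divC torC] := exists_divisible_torsion.
have sep (x : V) : exists f : V -> C,
    {morph f : u v / u - v} /\ (x != 0 -> f x != 0).
  have [-> | x_neq0] := eqVneq x 0.
    by exists (fun=> 0); split=> // u v; rewrite subrr.
  have [||m mP] := @int_subgroup_principal (fun k => x *~ k = 0).
  - exact: mulr0z.
  - by move=> a b xa xb; rewrite mulrzBr xa xb subrr.
  have [|c c_neq0 cm] := torC m.
    apply: contra_neqN x_neq0 => /eqP m1.
    by rewrite -[x]mulr1z; apply/mP; rewrite m1.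
  (* Adjoining ([x], [c]) to the zero graph gives the homomorphism on the subgroup generated by [x]
     that sends [x] to [c]. It is well defined because [c] is killed by the order [m] of [x]. *)
  have graph0 : @additive_graph V C [set 0].
    by split=> [p q -> -> | d [->]] //=; rewrite subrr.
  have xc k d : [set 0 : V * C] (x *~ k, d) -> d = c *~ k.
    move=> [xk ->]; have /dvdzP[q ->] : (m %| k)%Z by apply/mP.
    by rewrite mulrC mulrzA -[c *~ m]/(c *+ m) cm mul0rz.
  have [|f fB fP] := divisible_extension divC (additive_graph_adjoin graph0 xc).
    by exists 0, 0; rewrite /= !mulr0z !addr0.
  exists f; split=> // _; rewrite (fP x c) //.
  by exists 0, 1; rewrite /= !mulr1z !add0r.
have [f fP] := choice sep.
exists (V -> C : zmodType).
  move=> n d n_gt0; have [e eP] := choice (fun x => divC n (d x) n_gt0).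
  exists e; apply/funext => x; rewrite -[RHS]eP.
  by elim: (n) => // k IH; rewrite !mulrS -IH.
(* Distinct [u] and [v] are told apart by the coordinate indexed by [u - v]. *)
exists (fun v x => f x v) => [u v | u v /(congr1 (@^~ (u - v))) /= fuv].
  by apply/funext => x; rewrite (fP x).1.
apply/eqP; rewrite -subr_eq0; apply: contraT => /(fP (u - v)).2.
by rewrite (fP _).1 fuv subrr eqxx.
Qed.

(** * Coinduced modules and enough injectives *)

Section CoinducedModule.
Variables (S : pzRingType) (D : zmodType).

Definition additive_pred : pred (S -> D) :=
  fun f => `[< {morph f : x y / x - y} >].

Lemma additive_pred_closed : GRing.zmod_closed additive_pred.
Proof.
split; first by apply/asboolP => x y; rewrite subrr.
move=> f g /asboolP fB /asboolP gB; apply/asboolP => x y.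
rewrite -[LHS]/(f (x - y) - g (x - y)) fB gB.
rewrite -[RHS]/((f x - g x) - (f y - g y)) !opprB.
by rewrite [LHS]addrACA [RHS]addrACA; congr (_ + _); exact: addrC.
Qed.

HB.instance Definition _ :=
  GRing.isZmodClosed.Build (S -> D) additive_pred additive_pred_closed.

Definition coinduced := {f : S -> D | f \in additive_pred}.
HB.instance Definition _ := SubType.copy coinduced {f : S -> D | f \in additive_pred}.
HB.instance Definition _ := Choice.copy coinduced {f : S -> D | f \in additive_pred}.
HB.instance Definition _ := [SubChoice_isSubZmodule of coinduced by <:].

Definition coinduced_of (f : S -> D) (fB : {morph f : x y / x - y}) : coinduced :=
  exist _ f (asboolT fB).

Lemma coinducedB (f : coinduced) : {morph val f : x y / x - y}.
Proof. exact/asboolP/(valP f). Qed.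

Lemma coinducedD (f : coinduced) : {morph val f : x y / x + y}.
Proof.
have f0 : val f 0 = 0 by have := coinducedB f 0 0; rewrite !subrr.
by move=> x y; rewrite -{1}[y]opprK coinducedB -[- y]sub0r coinducedB f0 sub0r opprK.
Qed.

Lemma coinduced_scale_subproof (a : S) (f : coinduced) :
  {morph (fun s => val f (s * a)) : x y / x - y}.
Proof. by move=> x y; rewrite mulrBl coinducedB. Qed.

(** Multiplying the argument on the right yields a left action: both a(bf) and (ab)f send s to
    f(sab). *)
Definition coinduced_scale (a : S) (f : coinduced) : coinduced :=
  coinduced_of (coinduced_scale_subproof a f).

Lemma coinduced_scaleA a b f :
  coinduced_scale a (coinduced_scale b f) = coinduced_scale (a * b) f.
Proof. by apply/val_inj/funext => s /=; rewrite mulrA. Qed.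

Lemma coinduced_scale1 : left_id 1 coinduced_scale.
Proof. by move=> f; apply/val_inj/funext => s /=; rewrite mulr1. Qed.

Lemma coinduced_scaleDr : right_distributive coinduced_scale +%R.
Proof. by move=> a f g; apply/val_inj/funext => s. Qed.

Lemma coinduced_scaleDl f : {morph coinduced_scale^~ f : a b / a + b}.
Proof. by move=> a b; apply/val_inj/funext => s /=; rewrite mulrDr coinducedD. Qed.

HB.instance Definition _ := GRing.Zmodule_isLmodule.Build S coinduced
  coinduced_scaleA coinduced_scale1 coinduced_scaleDr coinduced_scaleDl.

(** This is one direction of the adjunction between coinduction and the forgetful functor to abelian
    groups; [f] is recovered by evaluation at 1. *)
Lemma linear_to_coinduced (B : lmodType S) (f : B -> D) :
    {morph f : x y / x - y} ->
  exists h : {linear B -> coinduced}, forall b s, val (h b) s = f (s *: b).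
Proof.
move=> fB.
have f0 : f 0 = 0 by have := fB 0 0; rewrite !subrr.
have fD x y : f (x + y) = f x + f y.
  by rewrite -{1}[y]opprK fB -[- y]sub0r fB f0 sub0r opprK.
have mB b : {morph (fun s => f (s *: b)) : x y / x - y}.
  by move=> x y; rewrite scalerBl fB.
have [|h hP] := @linear_of_fun S B coinduced (fun b => coinduced_of (mB b)).
  move=> a x y; apply/val_inj/funext => s /=.
  by rewrite scalerDr fD scalerA.
by exists h => b s; rewrite hP.
Qed.

End CoinducedModule.

Definition injective_module (S : pzRingType) (E : lmodType S) : Prop :=
  forall (A B : lmodType S) (i : {linear A -> B}), is_mono i ->
    forall g : {linear A -> E}, exists h : {linear B -> E}, forall x, h (i x) = g x.

(** By the adjunction it is enough to extend the additive map x |-> g(x)(1) along [i], which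
    divisibility of [D] allows. The set [G] is the graph of that map on the image of [i]. *)
Lemma coinduced_injective (S : pzRingType) (D : zmodType) :
  divisible D -> injective_module (coinduced S D).
Proof.
move=> divD A B i mono_i g.
pose G : set (B * D) := [set p | exists x, p = (i x, val (g x) 1)].
have graphG : additive_graph G.
  split=> [_ _ [x ->] [y ->] | d [x [ix ->]]].
    by exists (x - y); rewrite !raddfB.
  by rewrite (_ : x = 0) ?raddf0 //; apply: mono_i; rewrite -ix raddf0.
have [|f fB fP] := divisible_extension divD graphG.
  by exists 0; rewrite !raddf0.
have [h hP] := linear_to_coinduced fB; exists h => x.
apply/val_inj/funext => s; rewrite hP -linearZ_LR (fP _ (val (g (s *: x)) 1)).
  by rewrite linearZ_LR /= mul1r.
by exists (s *: x).
Qed.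

(** An additive embedding of [V] in a divisible group induces a linear map to the coinduced module;
    evaluation at 1 gives the embedding back, so the linear map is injective. *)
Lemma enough_injectives (S : pzRingType) (V : lmodType S) :
  exists2 E : lmodType S, injective_module E &
  exists j : {linear V -> E}, is_mono j.
Proof.
have [D divD [j jB inj_j]] := embed_in_divisible V.
exists (coinduced S D); first exact: coinduced_injective.
have [h hP] := @linear_to_coinduced S D V j jB; exists h => x y hxy.
by apply: inj_j; rewrite -[x]scale1r -[y]scale1r -!hP hxy.
Qed.

(** * Maps out of direct sums, and the trace of a module in an injective one *)

Lemma dsum_universal (S : pzRingType) (I : choiceType) (M E : lmodType S)
    (F : I -> {linear M -> E}) :
  exists h : {linear dsum I M -> E}, forall i x, exists d, h d = F i x.
Proof.
pose supp (d : dsum I M) := [set i | val d i != 0].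
have fin_d d : finite_set (supp d) by exact/asboolP/(valP d).
pose h (d : dsum I M) := \sum_(i \in [set: I]) F i (val d i).
(* The sum may be taken over any finite set containing the support, so sums for different elements
   can be compared over a common index set. *)
have hE (X : set I) d : finite_set X -> supp d `<=` X ->
    h d = \sum_(i <- fset_set X) F i (val d i).
  move=> finX dX; apply: fsbigTE => i; rewrite in_fset_set // notin_setE => nXi.
  have /eqP -> : val d i == 0 by apply: contraT => /dX /nXi.
  exact: raddf0.
have [|g gP] := @linear_of_fun S _ _ h.
  move=> a x y; pose X := supp x `|` supp y.
  have finX : finite_set X by rewrite finite_setU.
  have axyX : supp (a *: x + y) `<=` X.
    move=> i; rewrite /supp /=.
    rewrite -[X in X != 0]/(a *: val x i + val y i).
    case: (eqVneq (val x i) 0) => [x0 | ?]; last by left.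
    case: (eqVneq (val y i) 0) => [y0 | ?]; last by right.
    by rewrite x0 y0 scaler0 addr0 eqxx.
  rewrite !(hE X) //; [|by move=> i; right|by move=> i; left].
  rewrite scaler_sumr -big_split /=; apply: eq_bigr => i _.
  by rewrite -linearP.
exists g => i x.
(* The preimage of [F i x] is the family with [x] at [i] and 0 elsewhere. *)
pose f (k : I) := if k == i then x else 0.
have ff : f \in @fin_supp S I M.
  apply/asboolP/(sub_finite_set _ (finite_set1 i)) => k /=.
  by rewrite /f; case: (eqVneq k i) => // _; rewrite eqxx.
exists (exist _ f ff); rewrite gP (hE [set i]) ?finite_set1 //.
  by rewrite fset_set1 big_seq_fset1 /= /f eqxx.
by move=> k; rewrite /supp /= /f; case: (eqVneq k i) => // _; rewrite eqxx.
Qed.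

(* The trace of M in an injective module E: M-injective because a map from M
   to E lands in it, and an epimorphic image of M^(I), I = Hom(M, E). *)
Lemma trace_submodule (S : pzRingType) (M E : lmodType S) :
    injective_module E ->
  exists (A : lmodType S) (i : {linear A -> E}),
    [/\ is_mono i, M_injective M A,
        exists (I : Type) (h : {linear dsum I M -> A}), is_epi h &
        forall (g : {linear M -> E}) x, exists a, i a = g x].
Proof.
move=> injE.
(* The family consists of all linear maps from [M] to [E], indexed by themselves; [{classic _}]
   makes this index a choice type. *)
have [h hP] := @dsum_universal S {classic {linear M -> E}} M E id.
have [A [i [mono_i im_i]]] :=
  submodule_as_module (image_submodule h (setT_submodule _)).
have trace (g : {linear M -> E}) x : exists a, i a = g x.
  by have [d dE] := hP g x; apply/im_i; exists d.
exists A, i; split=> //.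
  move=> N alpha mono_alpha beta.
  have [g gP] := injE _ _ _ mono_alpha (i \o beta).
  have [gamma gammaP] := factor_through_mono mono_i (trace g).
  by exists gamma => x; apply: mono_i; rewrite gammaP gP.
have [|h' h'P] := factor_through_mono (g := h) mono_i.
  by move=> d; apply/im_i; exists d.
exists {classic {linear M -> E}}, h' => a.
have [d _ dE] : (h @` setT) (i a) by apply/im_i; exists a.
by exists d; apply: mono_i; rewrite h'P.
Qed.

(** * Finite powers of a module *)

Section PowerModule.
Variables (S : pzRingType) (M : lmodType S) (n : nat).

Definition Mpow_proj (i : 'I_n) (v : Mpow n M) : M := v i.

Lemma Mpow_proj_linear i : linear (Mpow_proj i).
Proof. by move=> a x y; rewrite /Mpow_proj !ffunE. Qed.

HB.instance Definition _ i :=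
  GRing.isLinear.Build S (Mpow n M) M _ (Mpow_proj i) (Mpow_proj_linear i).

Definition Mpow_inj (i : 'I_n) (x : M) : Mpow n M :=
  [ffun k => if k == i then x else 0].

Lemma Mpow_inj_linear i : linear (Mpow_inj i).
Proof.
move=> a x y; apply/ffunP => k; rewrite !ffunE.
by case: eqP => // _; rewrite scaler0 addr0.
Qed.

HB.instance Definition _ i :=
  GRing.isLinear.Build S M (Mpow n M) _ (Mpow_inj i) (Mpow_inj_linear i).

Lemma Mpow_inj_sum (v : Mpow n M) : v = \sum_i Mpow_inj i (Mpow_proj i v).
Proof.
apply/ffunP => k; rewrite sum_ffunE (bigD1 k) //= ffunE eqxx big1 ?addr0 //.
by move=> i /negPf ik; rewrite ffunE eq_sym ik.
Qed.

(** The restriction of [beta] to each of the n summands lifts by purity, and the lifts add up. *)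
Lemma M_pure_lift_Mpow (A B : lmodType S) (mu : {linear A -> B})
    (beta : {linear Mpow n M -> B}) : M_pure_epi M mu ->
  exists gamma : {linear Mpow n M -> A}, forall v, mu (gamma v) = beta v.
Proof.
move=> [_ pure_mu]; have [g gP] := choice (fun i => pure_mu (beta \o Mpow_inj i)).
have [|gamma gammaP] :=
    @linear_of_fun S _ _ (fun v : Mpow n M => \sum_i g i (Mpow_proj i v)).
  move=> a x y; rewrite scaler_sumr -big_split /=; apply: eq_bigr => i _.
  by rewrite !linearP.
exists gamma => v; rewrite gammaP raddf_sum [in RHS](Mpow_inj_sum v) raddf_sum.
by apply: eq_bigr => i _; exact: gP.
Qed.

End PowerModule.

(** * The implications between the three conditions *)

Section Equivalences.
Variables (S : pzRingType) (M : lmodType S).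

Lemma rickart_FM_closed_pure_epi : fin_sigma_rickart M -> FM_closed_pure_epi M.
Proof.
move=> rickM A A' mu FA pure_mu N alpha mono_alpha [n [n_gt0 [f epi_f]]] beta.
(* Following [f] by the embeddings of [N] in [M] and of [M] in its power as first summand turns it
   into an endomorphism with the same kernel, to which the Rickart property applies. *)
have ker_f : kernel f = kernel (Mpow_inj (Ordinal n_gt0) \o alpha \o f).
  apply/seteqP; split=> v; rewrite /kernel /= => fv; first by rewrite fv !raddf0.
  apply: mono_alpha; rewrite raddf0; move/ffunP/(_ (Ordinal n_gt0)): fv.
  by rewrite !ffunE eqxx.
have [|s sP] := epi_section epi_f.
  by rewrite ker_f; exact/direct_summand_retract/rickM.
have [g gP] := M_pure_lift_Mpow (beta \o f) pure_mu.
(* With [s] a section of [f] and [g] a lift of [beta \o f], the map [g \o s] lifts [beta] to [A],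
   where it extends to [M]. *)
have [gamma gammaP] := FA N alpha mono_alpha (ex_intro _ n (conj n_gt0
  (ex_intro _ f epi_f))) (g \o s).
by exists (mu \o gamma) => x /=; rewrite -gammaP /= gP /= sP.
Qed.

Lemma FM_closed_pure_epi_injectives :
  FM_closed_pure_epi M -> FM_contains_pure_epi_images_of_injectives M.
Proof. by move=> clFM A A' mu injA; apply: clFM => N alpha ma _; exact: injA. Qed.

Hypothesis projM : forall I : Type, rel_projective M (dsum I M).
Hypothesis imFM : FM_contains_pure_epi_images_of_injectives M.

(* V = M^k sits in the trace A of M in an injective module.  Projectivity makes
   A -> A / ker psi an M-pure epimorphism, so V / ker psi -> A / ker psi extends
   along V / ker psi -> M and then lifts to delta : M -> A.  On V, delta o psi
   differs from the inclusion by elements of ker psi, so it takes values in V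
   and id - delta o psi is a projection onto ker psi. *)
Lemma kernel_Mpow_retract k (psi : {linear Mpow k M -> M}) :
  (0 < k)%N -> is_retract (kernel psi).
Proof.
move=> k_gt0.
have [E injE [j mono_j]] := enough_injectives (Mpow k M).
have [A [i [mono_i injA [I [h epi_h]] trace]]] := trace_submodule M injE.
(* The embedding [j] lands in the trace since each vector is a sum of images of elements of [M]. *)
have [|j' j'P] := factor_through_mono (g := j) mono_i.
  move=> v; rewrite (Mpow_inj_sum v) raddf_sum /=.
  have [a aP] := choice (fun t => trace (j \o Mpow_inj t) (Mpow_proj t v)).
  by exists (\sum_t a t); rewrite raddf_sum; apply: eq_bigr => t _; exact: aP.
have mono_j' : is_mono j'.
  by move=> x y e; apply: mono_j; rewrite -!j'P e.
have [A' [mu [epi_mu ker_mu]]] :=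
  quotient_as_module (image_submodule j' (kernel_submodule psi)).
(* Projectivity lifts a map from [M] through the composite epimorphism [mu \o h]; following the lift
   by [h] gives the one into [A]. *)
have pure_mu : M_pure_epi M mu.
  split=> // beta; have [|g gP] := projM (g := mu \o h) _ beta.
    move=> q; have [a <-] := epi_mu q; have [d <-] := epi_h a.
    by exists d.
  by exists (h \o g) => x; exact: gP.
have [N [alpha [mono_alpha im_alpha]]] :=
  submodule_as_module (image_submodule psi (setT_submodule _)).
have [|f fP] := factor_through_mono (g := psi) mono_alpha.
  by move=> v; apply/im_alpha; exists v.
have epi_f : is_epi f.
  move=> y; have [v _ vE] : (psi @` setT) (alpha y) by apply/im_alpha; exists y.
  by exists v; apply: mono_alpha; rewrite fP.
(* The image [N] of [psi] serves as V / ker psi, and [beta] is the map it receives from [mu \o j'],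
   which vanishes on the kernel. *)
have [|beta betaP] := factor_through_epi (g := mu \o j') epi_f.
  move=> v fv; apply/ker_mu; exists v => //.
  by rewrite /kernel /= -fP fv raddf0.
have [|gamma gammaP] := imFM injA pure_mu mono_alpha _ beta.
  by exists k; split=> //; exists f.
have [delta deltaP] := pure_mu.2 gamma.
have diff v : exists2 u, psi u = 0 & j' u = j' v - delta (psi v).
  apply/ker_mu; rewrite raddfB /= deltaP -fP -gammaP betaP /=.
  exact: subrr.
have [|t tP] := factor_through_mono (g := delta \o psi) mono_j'.
  move=> v; have [u _ uE] := diff v.
  by exists (v - u); rewrite raddfB /= uE subKr.
exists (idfun \- t); split=> v; rewrite /kernel /=.
  have [u psiu uE] := diff v; rewrite (_ : v - t v = u) //.
  by apply: mono_j'; rewrite raddfB /= tP uE.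
move=> psiv; rewrite (_ : t v = 0) ?subr0 //.
by apply: mono_j'; rewrite tP /= psiv !raddf0.
Qed.

Lemma injectives_FM_rickart : fin_sigma_rickart M.
Proof.
move=> n n_gt0 phi; apply: retract_direct_summand; first exact: kernel_submodule.
have kerM (g : {linear Mpow n M -> M}) := kernel_Mpow_retract g n_gt0.
(* Coordinates are imposed one at a time: the empty list gives the whole module, the full list the
   kernel of [phi]. *)
suff retr (r : seq 'I_n) :
    is_retract [set v | forall i, i \in r -> Mpow_proj i (phi v) = 0].
  have [e [eK Ke]] := retr (enum 'I_n); exists e; split=> v.
    by apply/ffunP => i; rewrite ffunE; apply: (eK v); rewrite mem_enum.
  move=> phiv; apply: Ke => i _; rewrite phiv; exact: raddf0.
elim: r => [|i r IH]; first by exists idfun; split.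
have [e [eK Ke]] := retract_capI (Mpow_proj i \o phi) kerM IH.
exists e; split=> v.
  have [er ei] := eK v => k; rewrite inE => /orP[/eqP -> // | kr].
  exact: er.
move=> kv; apply: Ke; split=> [k kr|]; first by apply: kv; rewrite inE kr orbT.
by apply: kv; rewrite inE eqxx.
Qed.

End Equivalences.

Theorem mainTheorem7 (R : pzRingType) (M : lmodType R^c) :
  (fin_sigma_rickart M -> FM_closed_pure_epi M) /\
  (FM_closed_pure_epi M -> FM_contains_pure_epi_images_of_injectives M) /\
  ((forall I : Type, rel_projective M (dsum I M)) ->
     (fin_sigma_rickart M <-> FM_closed_pure_epi M) /\
     (FM_closed_pure_epi M <-> FM_contains_pure_epi_images_of_injectives M)).
Proof.
have i_ii := @rickart_FM_closed_pure_epi _ M.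
have ii_iii := @FM_closed_pure_epi_injectives _ M.
split=> //; split=> // projM.
have iii_i := injectives_FM_rickart projM.
by split; split=> // ?; [exact/iii_i/ii_iii | exact/i_ii/iii_i].
Qed.
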